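(* Let $G$ be a log-divergent graph with $n_G\ge 3$. Then for every prime power $q$ the $c_2$ invariants of $G$ in dual parametric space and in position space coincide: $$c_2^{\mathrm{dual}}(G)_q = c_2^{\mathrm{pos}}(G)_q \quad\text{in } \mathbb{Z}/q\mathbb{Z}.$$
   Context: Graphs are finite and may have multiple edges and self-loops. For a graph $G$ let $N_G$ be its number of edges $e_1,\dots,e_{N_G}$, $n_G=|V(G)|-1$, and $h_G=N_G-n_G$. $G$ is log-divergent if $N_G=2h_G$ (equivalently $N_G=2n_G$). Dual graph polynomial: $\varphi_G=\sum_T\prod_{e\in T}\alpha_e\in\mathbb{Z}[\alpha_1,\dots,\alpha_{N_G}]$, the sum running over the (edge sets of) spanning trees $T$ of $G$, with $\varphi_G=0$ if $G$ is disconnected. For polynomials $f_1,\dots,f_r\in\mathbb{Z}[a_1,\dots,a_N]$ and a prime power $q$, $[f_1,\dots,f_r]_q$ denotes the number of common zeros in $\mathbb{F}_q^N$ of the images of $f_1,\dots,f_r$ in $\mathbb{F}_q[a_1,\dots,a_N]$. If $h_G\ge 2$ then $q^2\mid[\varphi_G]_q$ (with $\varphi_G$ regarded as a polynomial in all $N_G$ variables), and $c_2^{\mathrm{dual}}(G)_q:=[\varphi_G]_q/q^2 \bmod q$. Position space: put $n=n_G$ and $|x|^2=x^1x^2+x^3x^4$ for a $4$-vector $x=(x^1,x^2,x^3,x^4)$. Label the vertices $1,\dots,n+1$, attach to vertex $p$ a 4-vector variable $x_p=(x_p^1,\dots,x_p^4)$ for $1\le p\le n$, and set $x_{n+1}=0$.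 For an edge $e_i$ with endpoints $s,t$ let $q_i(x)=|x_s-x_t|^2$, a polynomial in the $4n$ variables $x_p^j$ ($1\le p\le n$, $1\le j\le 4$). If $N_G\le 2n_G$ and $n_G\ge2$ then $q^2$ divides $[q_1q_2\cdots q_{N_G}]_q$, the number of points in $\mathbb{F}_q^{4n}$ at which the product $q_1\cdots q_{N_G}$ vanishes, and $c_2^{\mathrm{pos}}(G)_q:=[q_1\cdots q_{N_G}]_q/q^2 \bmod q$. *)

(* Defs.v *)
From HB Require Import structures.
From mathcomp Require Import all_boot all_order all_algebra.
From mathcomp Require Import mpoly.

Set Implicit Arguments.
Unset Strict Implicit.
Unset Printing Implicit Defensive.

Import GRing.Theory.

Local Open Scope ring_scope.

(* A finite graph with [(nG G).+1] labelled vertices and [NG G] labelled edges;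
   multiple edges and self-loops are allowed.  The order of the two components
   of [ends e] carries no meaning. *)
Record mgraph := MGraph {
  nG : nat;
  NG : nat;
  ends : 'I_NG -> 'I_nG.+1 * 'I_nG.+1 }.

Notation vertex G := 'I_(nG G).+1.
Notation edge G := 'I_(NG G).

(* Integer-valued: [NG G - nG G] truncated in [nat] would make an edgeless
   graph log-divergent. *)
Definition hG (G : mgraph) : int := (NG G)%:Z - (nG G)%:Z.

Definition log_divergent (G : mgraph) : Prop := (NG G)%:Z = 2 * hG G.

Definition joins (G : mgraph) (e : edge G) (x y : vertex G) : bool :=
  (ends e == (x, y)) || (ends e == (y, x)).

Definition adjacent (G : mgraph) (T : {set edge G}) : rel (vertex G) :=
  fun x y => [exists e in T, joins e x y].

Definition connected_by (G : mgraph) (T : {set edge G}) : bool :=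
  [forall x, forall y, connect (adjacent T) x y].

(* A cycle v_0 e_0 v_1 e_1 ... v_k e_k v_0 is the sequence of the pairs
   (v_i, e_i): the v_i are distinct, the e_i are distinct elements of [T], and
   e_i joins v_i to the next vertex cyclically.  A self-loop is a cycle of
   length 1, a pair of parallel edges a cycle of length 2. *)
Definition is_cycle (G : mgraph) (T : {set edge G})
    (c : seq (vertex G * edge G)) : bool :=
  [&& c != [::],
      uniq (unzip1 c),
      uniq (unzip2 c),
      all (fun s => s.2 \in T) c &
      path.cycle (fun s t => joins s.2 s.1 t.1) c].

(* The length of a cycle is at most the number of vertices, so quantifying over
   tuples of length k.+1 <= (nG G).+1 covers all cycles; see [acyclicP]. *)
Definition acyclic (G : mgraph) (T : {set edge G}) : bool :=
  ~~ [exists k : 'I_(nG G).+1,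
       [exists c : k.+1.-tuple (vertex G * edge G), is_cycle T c]].

Lemma acyclicP (G : mgraph) (T : {set edge G}) :
  reflect (forall c, ~~ is_cycle T c) (acyclic T).
Proof.
apply: (iffP idP) => [acT c | nc]; last first.
  by apply/negP => /existsP[k /existsP[c]]; apply/negP.
apply: contra acT => cc; case/and5P: (cc) => nz u1 _ _ _.
have /esym sc : (size c).-1.+1 = size c by case: (c) nz.
have lt_k : ((size c).-1 < (nG G).+1)%N.
  have := max_card (mem (unzip1 c)); rewrite (card_uniqP u1) size_map card_ord.
  by rewrite {1}sc.
apply/existsP; exists (Ordinal lt_k).
by apply/existsP; exists (tcast sc (in_tuple c)); rewrite val_tcast.
Qed.

Definition spanning_tree (G : mgraph) (T : {set edge G}) : bool :=
  connected_by T && acyclic T.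

Definition dual_poly (G : mgraph) : {mpoly int[NG G]} :=
  \sum_(T : {set edge G} | spanning_tree T) \prod_(e in T) 'X_e.

(* [f_1, ..., f_r]_q, where [F] is a field with q elements. *)
Definition point_count (F : finFieldType) (N : nat)
    (fs : seq {mpoly int[N]}) : nat :=
  #|[set a : {ffun 'I_N -> F} |
      all (fun f => (map_mpoly (intr : int -> F) f).@[a] == 0) fs]|.

(* The coordinates x^1, ..., x^4 are indexed by 0, 1, 2, 3 : 'I_4. *)
Definition norm4 (R : comNzRingType) (x : 'I_4 -> R) : R :=
  x 0 * x 1 + x 2 * x 3.

(* The 4n variables x_p^j are numbered by [mxvec_index]; the last vertex sits
   at the origin, and [unlift ord_max] identifies the others with 'I_n. *)
Definition position (G : mgraph) (v : vertex G) (j : 'I_4) :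
    {mpoly int[(nG G * 4)%N]} :=
  if unlift ord_max v is Some p then 'X_(mxvec_index p j) else 0.

Definition edge_poly (G : mgraph) (e : edge G) : {mpoly int[(nG G * 4)%N]} :=
  norm4 (fun j => position (ends e).1 j - position (ends e).2 j).

Definition position_poly (G : mgraph) : {mpoly int[(nG G * 4)%N]} :=
  \prod_(e : edge G) edge_poly e.

(* The quotients by q ^ 2 below are exact under the conditions under which the
   invariants are defined: 2 <= h_G for the dual one; N_G <= 2 n_G and 2 <= n_G
   for the position one. *)
Definition c2_dual (G : mgraph) (F : finFieldType) : 'Z_#|F| :=
  (point_count F [:: dual_poly G] %/ #|F| ^ 2)%N%:R.

Definition c2_pos (G : mgraph) (F : finFieldType) : 'Z_#|F| :=
  (point_count F [:: position_poly G] %/ #|F| ^ 2)%N%:R.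

(* Main.v *)
Require Import Defs.
From mathcomp Require Import all_boot all_order all_algebra all_fingroup.
From mathcomp Require Import mxabelem mpoly.
From mathcomp Require Import zify ring.

Set Implicit Arguments.
Unset Strict Implicit.
Unset Printing Implicit Defensive.

Import GRing.Theory.

Local Open Scope ring_scope.

(** With B the reduced incidence matrix (one row l_e per edge), the matrix-tree
    theorem gives phi_G(a) = det L(a) for L(a) = B^T diag(a) B = sum_e a_e l_e^T l_e.
    By inclusion-exclusion the zeros of prod_e q_e are governed by the numbers
    A_S of points with q_e = 0 for all e in S.  Exchanging a matrix with its
    transpose shows, as N = 2 n, that A_S = sum_a |ker L_S(a)|^2, where
    a runs over F^N and the rows of B outside S are replaced by 0.  Modulo q^3
    this is the number R(B_S) of a with det L_S(a) <> 0, because q^2 divides R(B)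
    whenever B has at least two more rows than columns; a zero row gives another
    factor q, so that only S = E contributes modulo q^3, namely q^N - [phi_G]_q.

    The divisibility is by deletion-contraction: after a change of basis some row
    is (c, 0), and with B' the contraction, det L(a) is affine in the corresponding
    variable t, so R(B) + R(B') is q times the number of the other variables for
    which det L does not vanish identically in t.  The latter means that
    a matrix K(a) depending linearly on these variables is injective.  The number
    of such a is congruent mod q to sum_a |ker K(a)|, which becomes divisible by q
    when the pairs (a, v) with K(a) v = 0 are counted by v first. *)

Definition gram (R : comNzRingType) m n (B : 'M[R]_(m, n)) (a : 'rV[R]_m) :
  'M[R]_n := B^T *m diag_mx a *m B.

Definition indic (R : comNzRingType) m (T : {set 'I_m}) : 'rV[R]_m :=
  \row_e (e \in T)%:R.

Lemma mulmx_diagC (R : comNzRingType) m (u a : 'rV[R]_m) :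
  u *m diag_mx a = a *m diag_mx u.
Proof. by rewrite !mul_mx_diag; apply/matrixP=> i j; rewrite !mxE ord1 mulrC. Qed.

Lemma gram_tr (R : comNzRingType) m n (B : 'M[R]_(m, n)) a :
  (gram B a)^T = gram B a.
Proof. by rewrite /gram !trmx_mul trmxK tr_diag_mx mulmxA. Qed.

(** * Weights with nonsingular Gram matrix, counted modulo powers of q *)

Section NondegenerateCount.

Variable F : finFieldType.
Local Notation q := #|F|.

Lemma card_ker m n (A : 'M[F]_(m, n)) :
  #|[set v : 'rV_m | v *m A == 0]| = (q ^ (m - \rank A))%N.
Proof.
rewrite -mxrank_ker -card_rowg; apply: eq_card => v.
by rewrite inE mem_rowg sub_kermx.
Qed.

(** Both sides count the pairs (a, v) with v A^T diag(a) C = 0, the left one by a and the right one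
    by v. By [mulmx_diagC] the row vectors a and v A^T can be exchanged, so the condition is linear
    in a as well. *)
Lemma sum_card_ker_swap k m p (A : 'M[F]_(m, k)) (C : 'M[F]_(m, p)) :
  (\sum_(a : 'rV[F]_m) q ^ (k - \rank (A^T *m diag_mx a *m C)) =
   \sum_(v : 'rV[F]_k) q ^ (m - \rank (diag_mx (v *m A^T) *m C)))%N.
Proof.
under eq_bigr => a _ do rewrite -card_ker -sum1dep_card big_mkcond.
under [RHS]eq_bigr => a _ do rewrite -card_ker -sum1dep_card big_mkcond.
rewrite exchange_big; apply: eq_bigr => v _; apply: eq_bigr => a _.
by rewrite !mulmxA mulmx_diagC.
Qed.

Lemma dvdn_sum_card_ker k m p (A : 'M[F]_(m, k)) (C : 'M[F]_(m, p)) :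
  (q ^ (m - p) %|
   \sum_(a : 'rV[F]_m) q ^ (k - \rank (A^T *m diag_mx a *m C)))%N.
Proof.
rewrite sum_card_ker_swap; apply: dvdn_sum => v _.
by apply: dvdn_exp2l; apply: leq_sub2l; apply: rank_leq_col.
Qed.

(** In the sum of kernel sizes a row-free matrix contributes 1 and any other a positive power of q,
    while the whole sum is divisible by q. *)
Lemma dvdn_card_row_free k m p (A : 'M[F]_(m, k)) (C : 'M[F]_(m, p)) :
  (p < m)%N ->
  (q %| #|[set a : 'rV_m | row_free (A^T *m diag_mx a *m C)]|)%N.
Proof.
move=> lt_pm; have /(dvdn_trans _) := dvdn_sum_card_ker A C.
move=> /(_ q); rewrite -{1}(expn1 q) dvdn_exp2l ?subn_gt0 // => /(_ isT).
rewrite (bigID (mem [set a : 'rV_m | row_free (A^T *m diag_mx a *m C)])) /=.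
rewrite (eq_bigr (fun=> 1%N)); last first.
  by move=> a; rewrite inE => /eqP->; rewrite subnn.
rewrite sum1_card dvdn_addl //; apply: dvdn_sum => a; rewrite inE => nfree.
rewrite -{1}(expn1 q); apply: dvdn_exp2l; rewrite subn_gt0 ltn_neqAle.
by rewrite rank_leq_row andbT.
Qed.

(* R(B) above. *)
Definition nondeg m n (B : 'M[F]_(m, n)) : nat :=
  (\sum_(a : 'rV[F]_m) (\det (gram B a) != 0%R))%N.

Lemma sum_rV_cons m (f : 'rV[F]_(1 + m) -> nat) :
  (\sum_a f a = \sum_(a : 'rV_m) \sum_(t : F) f (row_mx t%:M a))%N.
Proof.
rewrite exchange_big pair_big /=.
rewrite (reindex (fun u : F * 'rV_m => row_mx u.1%:M u.2 : 'rV_(1 + m))) //=.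
exists (fun a : 'rV_(1 + m) => (lsubmx a 0 0, rsubmx a)) => [[t a]|a] _ /=.
  by rewrite row_mxKl row_mxKr mxE eqxx mulr1n.
by rewrite -mx11_scalar hsubmxK.
Qed.

Lemma nondeg_mulmx_unit m n (B : 'M[F]_(m, n)) (P : 'M[F]_n) :
  P \in unitmx -> nondeg (B *m P) = nondeg B.
Proof.
rewrite unitmxE unitfE => nzP; apply: eq_bigr => a _.
have ->: gram (B *m P) a = P^T *m gram B a *m P.
  by rewrite /gram trmx_mul !mulmxA.
by rewrite !det_mulmx det_tr !mulf_eq0 (negbTE nzP) /= orbF.
Qed.

Lemma gram_row_perm (R : comNzRingType) m n (s : 'S_m) (B : 'M[R]_(m, n)) a :
  gram (row_perm s B) (col_perm s a) = gram B a.
Proof.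
apply/matrixP => i j; rewrite /gram !mul_mx_diag !mxE.
rewrite [RHS](reindex_perm s) /=.
by apply: eq_bigr => k _; rewrite !mxE.
Qed.

Lemma nondeg_row_perm m n (s : 'S_m) (B : 'M[F]_(m, n)) :
  nondeg (row_perm s B) = nondeg B.
Proof.
rewrite /nondeg (reindex (col_perm s)) /=; last first.
  by exists (col_perm s^-1%g) => a _; rewrite -col_permM ?mulgV ?mulVg col_perm1.
by apply: eq_bigr => a _; rewrite gram_row_perm.
Qed.

Lemma gram_col_mx0 m n (B : 'M[F]_(m, n)) t (a : 'rV_m) :
  gram (col_mx 0 B : 'M_(1 + m, n)) (row_mx t a) = gram B a.
Proof.
rewrite /gram diag_mx_row tr_col_mx trmx0 mul_row_block.
by rewrite !mul0mx !mulmx0 !add0r mul_row_col mul0mx add0r.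
Qed.

Lemma nondeg_col_mx0 m n (B : 'M[F]_(m, n)) :
  nondeg (col_mx 0 B : 'M_(1 + m, n)) = (q * nondeg B)%N.
Proof.
rewrite /nondeg sum_rV_cons big_distrr /=; apply: eq_bigr => a _.
by under eq_bigr => t _ do rewrite gram_col_mx0; rewrite sum_nat_const.
Qed.

Lemma row0_block_mx (R : Type) m n (u : 'M[R]_1) (v : 'rV_n) (w : 'cV_m)
    (z : 'M_(m, n)) :
  row 0 (block_mx u v w z : 'M_(1 + m, 1 + n)) = row_mx u v.
Proof.
rewrite block_mxEv; apply/rowP => j; rewrite [LHS]mxE.
have -> : 0 = lshift m (0 : 'I_1) :> 'I_(1 + m) by apply: val_inj.
exact: col_mxEu.
Qed.

Lemma row'0_block_mx (R : Type) m n (u : 'M[R]_1) (v : 'rV_n) (w : 'cV_m)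
    (z : 'M_(m, n)) :
  row' 0 (block_mx u v w z : 'M_(1 + m, 1 + n)) = row_mx w z.
Proof.
rewrite block_mxEv; apply/matrixP => i j; rewrite [LHS]mxE.
have -> : lift 0 i = rshift 1 i :> (ordinal (1 + m)) by apply: val_inj.
exact: col_mxEd.
Qed.

(** The row (c, 0) adds c^2 t to the corner entry only, and the determinant is linear in the first
    row. *)
Lemma det_gram_block m n (c : F) (b : 'cV[F]_m) (B : 'M[F]_(m, n)) t a :
  \det (gram (block_mx c%:M 0 b B : 'M_(1 + m, 1 + n)) (row_mx t%:M a)) =
  c ^+ 2 * t * \det (gram B a) + \det (gram (row_mx b B) a).
Proof.
have gramE : gram (block_mx c%:M 0 b B : 'M_(1 + m, 1 + n)) (row_mx t%:M a) =
    block_mx ((c ^+ 2 * t)%:M) 0 0 0 + gram (row_mx b B) a.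
  rewrite /gram diag_mx_row tr_block_mx trmx0 tr_scalar_mx tr_row_mx.
  rewrite mulmx_block !mul0mx !mulmx0 !addr0 !add0r mulmx_block.
  rewrite !mulmx0 mul0mx !add0r mul_col_mx mul_col_row add_block_mx !add0r.
  congr block_mx; congr (_ + _).
  have ->: diag_mx (t%:M : 'rV_1) = t%:M.
    by apply/matrixP => i j; rewrite !mxE !ord1 !eqxx !mulr1n.
  by rewrite -!scalar_mxM; congr _%:M; ring.
have gramC : gram (row_mx b B) a =
    block_mx (b^T *m diag_mx a *m b) (b^T *m diag_mx a *m B)
             (B^T *m diag_mx a *m b) (gram B a).
  by rewrite /gram tr_row_mx mul_col_mx mul_col_row.
rewrite gramE gramC add_block_mx !add0r.
set g := (X in _ = _ + \det X).
pose Bl := block_mx (1%:M : 'M_1) 0 (B^T *m diag_mx a *m b) (gram B a).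
rewrite (@determinant_multilinear _ _ _ Bl g 0 (c ^+ 2 * t) 1).
- by rewrite det_lblock det1 !mul1r.
- rewrite !row0_block_mx scale1r scale_row_mx add_row_mx scaler0 add0r.
  by rewrite scalemx1.
- by rewrite !row'0_block_mx.
by rewrite !row'0_block_mx.
Qed.

(** A kernel vector w on the left yields the kernel vectors w and (0, w) of the two Gram matrices;
    the converse rests on their symmetry. By [det_gram_block] the right side says that the
    determinant is not identically zero in t. *)
Lemma row_free_gram_row_mx m n (b : 'cV[F]_m) (B : 'M[F]_(m, n)) a :
  row_free (B^T *m diag_mx a *m row_mx b B) =
  ~~ ((\det (gram B a) == 0) && (\det (gram (row_mx b B) a) == 0)).
Proof.
set K := B^T *m _ *m _; rewrite -kermx_eq0.
have kerK (w : 'rV_n) : w != 0 -> w *m K = 0 -> kermx K != 0.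
  move=> nzw wK; apply: contraNneq nzw => kK0.
  by rewrite -submx0 -kK0 sub_kermx wK.
have KE : K = row_mx (B^T *m diag_mx a *m b) (gram B a).
  by rewrite /K mul_mx_row.
have gramE : gram (row_mx b B) a = col_mx (b^T *m diag_mx a *m row_mx b B) K.
  by rewrite /gram tr_row_mx !mul_col_mx.
clearbody K; apply/idP/idP => [|]; last first.
  apply: contraR => /rowV0Pn[w /sub_kermxP wK nzw].
  apply/andP; split; apply/det0P.
    exists w => //; move: wK; rewrite KE mul_mx_row => /eqP.
    by rewrite row_mx_eq0 => /andP[_ /eqP].
  exists (row_mx 0 w); first by rewrite row_mx_eq0 (negbTE nzw) andbF.
  by rewrite gramE mul_row_col mul0mx add0r.
apply: contraL => /andP[/det0P[w nzw wG] /det0P[v nzv]].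
rewrite -(hsubmxK v) gramE mul_row_col; move: nzv.
rewrite -{1}(hsubmxK v) row_mx_eq0.
move: (lsubmx v) (rsubmx v) => s u nzsu vG.
(* For w in the kernel of [gram B a], pairing v = (s, u) with (0, w) forces s = 0
   unless w is already in the kernel of K. *)
have [wb0|nzwb] := eqVneq (w *m (B^T *m diag_mx a *m b)) 0.
  by apply: (kerK w nzw); rewrite KE mul_mx_row wb0 wG row_mx0.
have s0 : s = 0.
  have := congr1 (fun x => x *m col_mx 0 w^T) vG.
  rewrite mul0mx mulmxDl -!mulmxA KE mul_row_col mulmx0 add0r.
  rewrite mul_row_col mulmx0 add0r -[gram B a]gram_tr -trmx_mul wG trmx0 mulmx0.
  rewrite addr0 => /(congr1 trmx); rewrite trmx0 !trmx_mul !trmxK tr_diag_mx => sb0.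
  apply: contraNeq nzwb => nzs; move: sb0; rewrite (mx11_scalar s) tr_scalar_mx.
  rewrite mul_mx_scalar => /eqP; rewrite scaler_eq0.
  have -> : (s 0 0 == 0) = false.
    by apply: contraNF nzs => /eqP s0; rewrite (mx11_scalar s) s0 raddf0.
  by rewrite !mulmxA.
apply: (kerK u); first by move: nzsu; rewrite s0 eqxx.
by move: vG; rewrite s0 mul0mx add0r.
Qed.

(** For nonzero x exactly one t is a zero, and the second summand makes up for it. In [nondeg_block]
    these summands add up to the contraction term. *)
Lemma sum_affine_neq0 (x y : F) :
  (\sum_(t : F) (t * x + y != 0)%R + (x != 0%R) =
   q * ~~ ((x == 0%R) && (y == 0%R)))%N.
Proof.
have [->|nzx] /= := eqVneq x 0.
  under eq_bigr do rewrite mulr0 add0r.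
  by rewrite sum_nat_const addn0 mulnC.
rewrite muln1 (bigD1 (- y / x)) //= divfK // addNr eqxx add0n.
rewrite (eq_bigr (fun=> 1%N)); last first.
  move=> t neq_t; suff ->: t * x + y != 0 by [].
  apply: contraNneq neq_t => txy; apply/eqP.
  by apply: (mulIf nzx); rewrite divfK //; apply/eqP; rewrite -addr_eq0 txy.
by rewrite sum1_card cardC1 addn1 prednK //; apply/card_gt0P; exists 0.
Qed.

Lemma nondeg_block m n (c : F) (b : 'cV[F]_m) (B : 'M[F]_(m, n)) : c != 0 ->
  (nondeg (block_mx c%:M 0 b B : 'M_(1 + m, 1 + n)) + nondeg B =
   q * #|[set a : 'rV_m | row_free (B^T *m diag_mx a *m row_mx b B)]|)%N.
Proof.
move=> nzc; rewrite -sum1dep_card big_mkcond big_distrr /= /nondeg sum_rV_cons.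
rewrite -big_split /=; apply: eq_bigr => a _.
rewrite row_free_gram_row_mx; have nzc2 : c ^+ 2 != 0 by rewrite expf_neq0.
have -> : (\det (gram B a) == 0) = (c ^+ 2 * \det (gram B a) == 0).
  by rewrite mulf_eq0 (negbTE nzc2).
set y := \det (gram (row_mx b B) a).
under eq_bigr => t _.
  rewrite det_gram_block mulrAC [X in X + _]mulrC; over.
by rewrite sum_affine_neq0; case: (~~ _).
Qed.

Lemma unitmx_to_scaled_delta n (u : 'rV[F]_(1 + n)) : u != 0 ->
  exists c P, [/\ c != 0, P \in unitmx & u *m P = row_mx c%:M 0].
Proof.
move=> nzu; exists (col_ebase u 0 0), (invmx (row_ebase u)); split.
- have := col_ebase_unit u; rewrite unitmxE unitfE.
  by rewrite {1}(mx11_scalar (col_ebase u)) det_scalar1.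
- by rewrite unitmx_inv row_ebase_unit.
rewrite -{1}(mulmx_ebase u) mulmxK ?row_ebase_unit // rank_rV nzu /=.
by rewrite -mx11_scalar pid_mx_row mul_mx_row mulmx1 mulmx0.
Qed.

(** Induction on the number of columns. Contraction removes one row and one column, so the excess of
    rows is preserved, and (b, B') still has more rows than columns. Without columns the determinant
    is 1 and the count is q^m. *)
Lemma dvdn2_nondeg n m (B : 'M[F]_(m, n)) :
  (n.+2 <= m)%N -> (q ^ 2 %| nondeg B)%N.
Proof.
elim: n m B => [|n IHn] m B lt_nm.
  rewrite /nondeg (eq_bigr (fun=> 1%N)) => [|a _]; last first.
    by rewrite det_mx00 oner_neq0.
  by rewrite sum1_card card_mx mul1n dvdn_exp2l.
have [B0|nzB] := eqVneq B 0.
  rewrite /nondeg big1 // => a _; rewrite /gram B0 mulmx0 det0 eqxx //.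
case: m => // m in B lt_nm nzB *.
have [e nze] : exists e, row e B != 0.
  apply/existsP; apply: contraNT nzB; rewrite negb_exists => /forallP row0.
  by apply/eqP/row_matrixP => i; rewrite linear0; apply/eqP; rewrite -[_ == _]negbK.
rewrite -(nondeg_row_perm (tperm e 0)).
set B1 : 'M_(1 + m, 1 + n) := row_perm _ B.
have B1r : usubmx B1 = row e B.
  apply/rowP => j; rewrite !mxE; congr (B _ _).
  by rewrite -[RHS](tpermR e 0); congr (tperm _ _ _); apply: val_inj.
rewrite -B1r in nze.
have [c [P [nzc unitP uP]]] := unitmx_to_scaled_delta nze.
rewrite -(nondeg_mulmx_unit B1 unitP).
have -> : B1 *m P = block_mx c%:M 0 (lsubmx (dsubmx (B1 *m P)))
                                    (rsubmx (dsubmx (B1 *m P))).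
  by rewrite block_mxEv hsubmxK -uP mul_usub_mx vsubmxK.
move: (lsubmx _) (rsubmx _) => b B'.
have /dvdn_addl <- : (q ^ 2 %| nondeg B')%N by apply: IHn.
by rewrite (nondeg_block b B' nzc) dvdn_mul ?dvdn_card_row_free.
Qed.

Lemma dvdn3_nondeg m n (B : 'M[F]_(m, n)) (e : 'I_m) :
  (n.+3 <= m)%N -> row e B = 0 -> (q ^ 3 %| nondeg B)%N.
Proof.
case: m => // m in B e *; rewrite ltnS => lt_nm row0.
rewrite -(nondeg_row_perm (tperm e 0)).
set B1 : 'M_(1 + m, n) := row_perm _ B.
have -> : B1 = col_mx 0 (dsubmx B1).
  rewrite -[LHS]vsubmxK; congr col_mx; apply/rowP => j; rewrite !mxE.
  rewrite (_ : tperm e 0 _ = e); first by move/rowP/(_ j): row0; rewrite !mxE.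
  by rewrite -[RHS](tpermR e 0); congr (tperm _ _ _); apply: val_inj.
by rewrite nondeg_col_mx0 expnS dvdn_mul // dvdn2_nondeg.
Qed.

(** * Isotropic configurations and kernels of Gram matrices *)

Definition isotropic m n (B : 'M[F]_(m, n)) (X : 'M[F]_(n, 4)) : bool :=
  [forall e, norm4 ((B *m X) e) == 0].

(** Columns 0 and 2 are separated from 1 and 3 because [norm4] pairs them bilinearly: once a and c
    are fixed, isotropy is a linear system in z. *)
Lemma sum_mx4 n (f : 'M[F]_(n, 4) -> nat) :
  (\sum_X f X =
   \sum_(a : 'rV[F]_n) \sum_(c : 'rV[F]_n) \sum_(z : 'rV[F]_(n + n))
     f (\matrix_(p, j) nth 0%R
          [:: a 0%R p; lsubmx z 0%R p; c 0%R p; rsubmx z 0%R p] j))%N.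
Proof.
rewrite pair_big pair_big /=.
pose g (X : 'M[F]_(n, 4)) : 'rV[F]_n * 'rV[F]_n * 'rV[F]_(n + n) :=
  ((col 0 X)^T, (col 2 X)^T, row_mx (col 1 X)^T (col 3 X)^T).
rewrite (reindex (fun u : 'rV[F]_n * 'rV[F]_n * 'rV[F]_(n + n) =>
  \matrix_(p < n, j < 4) nth 0 [:: u.1.1 0 p; lsubmx u.2 0 p;
                                   u.1.2 0 p; rsubmx u.2 0 p] j)) //=.
exists g => [[[a c] z] _ | X _] /=; last first.
  apply/matrixP => p j; rewrite mxE /= row_mxKl row_mxKr !mxE.
  by case: j => [[|[|[|[|//]]]] lt_j] /=; congr (X _ _); apply: val_inj.
rewrite /g; congr (_, _, _); last (rewrite -[RHS]hsubmxK; congr row_mx).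
all: by apply/rowP => p; rewrite !mxE.
Qed.

Lemma isotropicE m n (B : 'M[F]_(m, n)) (a c : 'rV[F]_n) (z : 'rV[F]_(n + n)) :
  isotropic B (\matrix_(p, j) nth 0
      [:: a 0 p; lsubmx z 0 p; c 0 p; rsubmx z 0 p] j) =
  (z *m (row_mx (diag_mx (a *m B^T) *m B) (diag_mx (c *m B^T) *m B))^T == 0).
Proof.
rewrite tr_row_mx -{3}(hsubmxK z) mul_row_col !trmx_mul !tr_diag_mx !mulmxA.
have BXE (x : 'rV[F]_n) (X : 'M[F]_(n, 4)) e j :
    (forall p, X p j = x 0 p) -> (B *m X) e j = (x *m B^T) 0 e.
  by move=> Xj; rewrite !mxE; apply: eq_bigr => p _; rewrite Xj mxE mulrC.
rewrite !mul_mx_diag; apply/forallP/eqP => [iso | /rowP z0 e].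
  apply/rowP => e; have /eqP := iso e; rewrite /norm4.
  rewrite (BXE a); last by move=> p; rewrite mxE.
  rewrite (BXE (lsubmx z)); last by move=> p; rewrite mxE.
  rewrite (BXE c); last by move=> p; rewrite mxE.
  rewrite (BXE (rsubmx z)); last by move=> p; rewrite mxE.
  move=> iso_e; rewrite [LHS]mxE [RHS]mxE -iso_e.
  by congr (_ + _); rewrite [LHS]mxE mulrC.
apply/eqP; have := z0 e; rewrite [LHS]mxE [RHS]mxE => <-; rewrite /norm4.
rewrite (BXE a); last by move=> p; rewrite mxE.
rewrite (BXE (lsubmx z)); last by move=> p; rewrite mxE.
rewrite (BXE c); last by move=> p; rewrite mxE.
rewrite (BXE (rsubmx z)); last by move=> p; rewrite mxE.
by congr (_ + _); rewrite [RHS]mxE mulrC.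
Qed.

Lemma card_isotropic m n (B : 'M[F]_(m, n)) : m = (n + n)%N ->
  #|[set X | isotropic B X]| =
  (\sum_(a : 'rV[F]_m) (q ^ (n - \rank (gram B a))) ^ 2)%N.
Proof.
move=> mE; rewrite -sum1dep_card big_mkcond /= sum_mx4.
under [RHS]eq_bigr => a _.
  rewrite -card_ker -sum1dep_card big_mkcond /= expnS expn1 big_distrlr /=.
  over.
rewrite [RHS]exchange_big /=; apply: eq_bigr => x _.
rewrite [RHS]exchange_big /=; apply: eq_bigr => y _.
under eq_bigr => z _ do rewrite isotropicE.
set W := row_mx _ _.
(* [W] is square since m = n + n, so [W] and its transpose have left kernels of equal size. A row a
   kills [W] exactly when x and y both lie in the kernel of [gram B a]. *)
rewrite -big_mkcond sum1dep_card card_ker mxrank_tr -[X in (X - _)%N]mE -card_ker.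
rewrite -sum1dep_card big_mkcond; apply: eq_bigr => a _.
rewrite /W mul_mx_row row_mx_eq0 /gram !mulmxA -2!(mulmx_diagC a).
by do 2!case: eqP.
Qed.

Lemma card_isotropic_mod m n (B : 'M[F]_(m, n)) : m = (n + n)%N -> (2 <= n)%N ->
  (#|[set X | isotropic B X]| = nondeg B %[mod q ^ 3])%N.
Proof.
move=> mE n_ge2; rewrite (card_isotropic B mE).
have q_dvd2 : (q ^ 2 %| nondeg B)%N by apply: dvdn2_nondeg; rewrite mE; lia.
have q_dvd2' : (q ^ 2 %| \sum_(a : 'rV[F]_m) q ^ (n - \rank (gram B a)))%N.
  apply: dvdn_trans (dvdn_sum_card_ker B B).
  by rewrite dvdn_exp2l // mE addnK.
have nondegE (a : 'rV_m) : (\det (gram B a) != 0) = (n - \rank (gram B a) == 0)%N.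
  rewrite -unitfE -unitmxE -row_free_unit /row_free subn_eq0 eqn_leq.
  by rewrite rank_leq_row.
(* Here d is the nullity of [gram B a]. For d = 0 the sides agree up to order, for d = 1 both are
   q^2, and for larger d both are divisible by q^3. *)
have pointwise d : ((q ^ d) ^ 2 + q * (d == 0) = q * q ^ d + (d == 0) %[mod q ^ 3])%N.
  case: d => [|[|d]]; first by rewrite addnC.
    by rewrite muln0 !addn0 expn1.
  rewrite !muln0 !addn0 -expnM -expnS.
  by apply/eqP; rewrite eqn_mod_dvd ?dvdn_sub ?dvdn_exp2l ?leq_pexp2l //; try lia;
    apply/card_gt0P; exists 0.
set A := (X in (X = _ %[mod _])%N).
have : (A + q * nondeg B =
    q * (\sum_(a : 'rV[F]_m) q ^ (n - \rank (gram B a))) + nondeg B %[mod q ^ 3])%N.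
  rewrite /A /nondeg !big_distrr -!big_split /=.
  elim/big_ind2: _ => // [x1 y1 x2 y2 e1 e2|a _].
    by rewrite -modnDm e1 e2 modnDm.
  by rewrite nondegE pointwise.
have q3 k : (q ^ 2 %| k -> q * k = 0 %[mod q ^ 3])%N.
  by move=> dvd_k; rewrite mod0n; apply/eqP; rewrite -/(dvdn _ _) expnS dvdn_mul.
by rewrite -modnDmr (q3 _ q_dvd2) -[RHS]modnDml (q3 _ q_dvd2') mod0n addn0 add0n.
Qed.

Lemma dvdn3_card_isotropic_diag m n (B : 'M[F]_(m, n)) (S : {set 'I_m}) :
  m = (n + n)%N -> (3 <= n)%N -> S != [set: 'I_m] ->
  (q ^ 3 %| #|[set X | isotropic (diag_mx (indic F S) *m B) X]|)%N.
Proof.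
move=> mE n_ge3; rewrite -subTset => /subsetPn[e _ eS].
rewrite /dvdn card_isotropic_mod //; last lia.
apply: (@dvdn3_nondeg _ _ _ e); first lia.
by apply/rowP => j; rewrite mul_diag_mx !mxE (negbTE eS) mul0r.
Qed.

End NondegenerateCount.

(** * Inclusion-exclusion over the edges *)

Section InclusionExclusion.

Variable F : finFieldType.
Local Notation q := #|F|.

Lemma isotropic_diag m n (B : 'M[F]_(m, n)) (S : {set 'I_m}) X :
  isotropic (diag_mx (indic F S) *m B) X =
  [forall e in S, norm4 ((B *m X) e) == 0].
Proof.
apply: eq_forallb => e; rewrite -mulmxA mul_diag_mx /norm4 !mxE.
by case: (e \in S); rewrite ?mul1r // !mul0r addr0 eqxx.
Qed.

Lemma card_norm4_eq0_mod m n (B : 'M[F]_(m, n)) : m = (n + n)%N -> (3 <= n)%N ->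
  (q ^ 3 %| #|[set X | [exists e, norm4 ((B *m X) e) == 0%R]]| + nondeg B)%N.
Proof.
move=> mE n_ge3; set Z := #|_|.
pose A (S : {set 'I_m}) := #|[set X | isotropic (diag_mx (indic F S) *m B) X]|.
have incl_excl : (q ^ (n * 4))%N%:Z - Z%:Z =
    \sum_(S : {set 'I_m}) (-1) ^+ #|S| * (A S)%:Z.
  have -> : (q ^ (n * 4))%N%:Z - Z%:Z =
      \sum_(X : 'M[F]_(n, 4)) \prod_(e < m) (- (norm4 ((B *m X) e) == 0)%:R + 1).
    rewrite -card_mx -(cardsC [set X | [exists e, norm4 ((B *m X) e) == 0]]).
    rewrite PoszD addrC addKr -sum1_card -natz natr_sum big_mkcond /=.
    apply: eq_bigr => X _; rewrite !inE.
    have [/existsP[e Xe]|nX] := boolP [exists e, norm4 ((B *m X) e) == 0].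
      by rewrite (bigD1 e) //= Xe addNr mul0r.
    rewrite big1 // => e _; move: nX; rewrite negb_exists => /forallP/(_ e)/negbTE->.
    by rewrite oppr0 add0r.
  under eq_bigr => X _ do rewrite bigA_distr.
  rewrite exchange_big /=; apply: eq_bigr => S _.
  rewrite /A -sum1dep_card -natz natr_sum big_distrr [RHS]big_mkcond /=.
  apply: eq_bigr => X _; rewrite isotropic_diag -big_mkcond /=.
  have [/forall_inP SX|nSX] := boolP [forall e in S, norm4 ((B *m X) e) == 0].
    rewrite mulr1 (eq_bigr (fun=> -1)) ?prodr_const // => e eS.
    by rewrite SX.
  move: nSX; rewrite negb_forall => /existsP[e].
  by rewrite negb_imply => /andP[eS /negbTE Xe]; rewrite (bigD1 e) //= Xe oppr0 mul0r.
have AT : A [set: 'I_m] = #|[set X | isotropic B X]|.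
  apply: eq_card => X; rewrite !inE isotropic_diag.
  by apply: eq_forallb => e; rewrite inE.
have dvd_sum : ((q ^ 3)%N%:Z %|
    (q ^ (n * 4))%N%:Z - Z%:Z - (A [set: 'I_m])%:Z)%Z.
  rewrite incl_excl (bigD1 [set: 'I_m]) //= cardsT card_ord.
  (* As m is even, the full set enters with sign +1. *)
  rewrite -signr_odd {1}mE oddD addbb mul1r addrAC subrr add0r.
  apply: rpred_sum => S nT; apply: dvdz_mull; apply: (dvdn3_card_isotropic_diag B mE n_ge3 nT).
have AE := card_isotropic_mod B mE (ltnW n_ge3); rewrite -AT in AE.
have q4n : (q ^ 3 %| q ^ (n * 4))%N by rewrite dvdn_exp2l //; lia.
rewrite /dvdn -modnDmr -AE modnDmr -/(dvdn _ _).
have : ((q ^ 3)%N%:Z %| (q ^ (n * 4))%N%:Z - (Z + A [set: 'I_m])%N%:Z)%Z.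
  by rewrite PoszD opprD addrA.
move=> dvd_diff; suff : ((q ^ 3)%N%:Z %| (Z + A [set: 'I_m])%N%:Z)%Z by [].
by rewrite -[X in (_ %| X)%Z](subKr (q ^ (n * 4))%N%:Z) rpredB.
Qed.

(** Each count becomes divisible by q^3 after adding [nondeg B]; for the determinant the sum is the
    number q^m of all weights, with m at least 6. *)
Lemma card_norm4_eq0_det m n (B : 'M[F]_(m, n)) : m = (n + n)%N -> (3 <= n)%N ->
  (#|[set X | [exists e, norm4 ((B *m X) e) == 0%R]]| =
   #|[set a | \det (gram B a) == 0%R]| %[mod q ^ 3])%N.
Proof.
move=> mE n_ge3; have dvd1 := card_norm4_eq0_mod B mE n_ge3.
have dvd2 : (q ^ 3 %| #|[set a | \det (gram B a) == 0%R]| + nondeg B)%N.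
  rewrite /nondeg; have -> : (\sum_a (\det (gram B a) != 0%R) =
      #|~: [set a | \det (gram B a) == 0%R]|)%N.
    rewrite -sum1_card [RHS]big_mkcond; apply: eq_bigr => a _.
    by rewrite !inE; case: eqP.
  by rewrite cardsC card_mx mul1n dvdn_exp2l //; lia.
apply/eqP; rewrite -(eqn_modDr (nondeg B)).
by move: dvd1 dvd2; rewrite /dvdn => /eqP-> /eqP->.
Qed.

End InclusionExclusion.

(** * Cauchy-Binet expansion *)

Lemma det_mulmx_expand (R : comNzRingType) m n (A : 'M[R]_(n, m))
    (C : 'M[R]_(m, n)) :
  \det (A *m C) =
  \sum_(g : {ffun 'I_n -> 'I_m}) (\prod_i A i (g i)) * \det (rowsub g C).
Proof.
under [RHS]eq_bigr => g _ do rewrite big_distrr.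
rewrite exchange_big; apply: eq_bigr => s _ /=.
under eq_bigr => i _ do rewrite mxE.
rewrite bigA_distr_bigA big_distrr /=; apply: eq_bigr => g _.
rewrite big_split mulrCA; congr (_ * (_ * _)).
by apply: eq_bigr => i _; rewrite mxE.
Qed.

(** Both a and the indicator of T admit the same expansion over injective g. For the indicator only
    the g with image inside T survive, and that image is T because its size is n; so grouping g by
    image gives the coefficients. *)
Lemma det_gram_expand (R : comNzRingType) m n (B : 'M[R]_(m, n)) (a : 'rV[R]_m) :
  \det (gram B a) =
  \sum_(T : {set 'I_m} | #|T| == n)
     (\prod_(e in T) a 0 e) * \det (gram B (indic R T)).
Proof.
have expand (b : 'rV[R]_m) : \det (gram B b) =
    \sum_(g : {ffun 'I_n -> 'I_m} | injectiveb g)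
       (\prod_i b 0 (g i)) * (\prod_i B (g i) i * \det (rowsub g B)).
  rewrite /gram det_mulmx_expand (bigID (fun g : {ffun _} => injectiveb g)) /=.
  rewrite [X in _ + X]big1 ?addr0 => [|g /injectivePn[i [j neq_ij gij]]].
    apply: eq_bigr => g _; rewrite mulrA -big_split; congr (_ * _).
    by apply: eq_bigr => i _; rewrite mul_mx_diag !mxE mulrC.
  rewrite (determinant_alternate neq_ij) ?mulr0 // => k.
  by rewrite !mxE gij.
under [RHS]eq_bigr => T _ do rewrite expand big_distrr /=.
rewrite expand exchange_big /=; apply: eq_bigr => g /injectiveP g_inj.
have card_im : #|g @: setT| == n by rewrite card_imset // cardsT card_ord.
rewrite (bigD1 (g @: setT)) //= [X in _ = _ + X]big1 ?addr0 => [|T /andP[/eqP cT neqT]].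
  rewrite big_imset /=; last by move=> x y _ _; apply: g_inj.
  rewrite [X in _ = _ * (X * _)]big1 ?mul1r => [|i _].
    by congr (_ * _); apply: eq_bigl => i; rewrite inE.
  by rewrite mxE imset_f.
have [i giT] : exists i, g i \notin T.
  apply/existsP; apply: contraNT neqT; rewrite negb_exists => /forallP gT.
  rewrite eq_sym eqEcard cT (eqP card_im) leqnn andbT; apply/subsetP => _ /imsetP[i _ ->].
  by rewrite -[_ \in _]negbK.
by rewrite [X in _ * (X * _)](bigD1 i) //= mxE (negbTE giT) !mul0r mulr0.
Qed.

(** It factors the projection onto the edges of T through dimension [#|T|], which gives a lower and
    an upper bound on [#|T|] and, for [#|T|] = n, a square matrix. *)
Definition selection m (T : {set 'I_m}) : 'M[int]_(#|T|, m) :=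
  rowsub (@enum_val _ (mem T)) 1%:M.

Lemma selection_tr_mul m (T : {set 'I_m}) :
  (selection T)^T *m selection T = diag_mx (indic int T).
Proof.
apply/matrixP => e f; rewrite !mxE; under eq_bigr => i _ do rewrite !mxE.
have [eT|eT] := boolP (e \in T); last first.
  rewrite mul0rn big1 // => i _.
  suff /negbTE-> : enum_val i != e by rewrite mul0r.
  by apply: contraNneq eT => <-; apply: enum_valP.
rewrite (bigD1 (enum_rank_in eT e)) //= enum_rankK_in // eqxx mul1r.
rewrite big1 ?addr0 // => i neq_i.
suff /negbTE-> : enum_val i != e by rewrite mul0r.
by apply: contraNneq neq_i => eE; apply/eqP/enum_val_inj; rewrite enum_rankK_in.
Qed.

Lemma map_gram (R : comNzRingType) m n (B : 'M[int]_(m, n)) (a : 'rV[int]_m) :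
  map_mx intr (gram B a) = gram (map_mx intr B) (map_mx intr a) :> 'M[R]_n.
Proof. by rewrite /gram !map_mxM map_trmx map_diag_mx. Qed.

(** * Spanning trees and the incidence matrix *)

Section Graph.

Variable G : mgraph.
Implicit Types (T : {set edge G}) (x y : vertex G) (e : edge G).

Lemma adjacent_sym T : ssrbool.symmetric (adjacent T).
Proof. by move=> x y; apply: eq_existsb => e; rewrite /joins orbC. Qed.

Lemma connect_adjacent_sym T : connect_sym (adjacent T).
Proof. exact/sym_connect_sym/adjacent_sym. Qed.

Lemma adjacent_ends T e : e \in T -> adjacent T (ends e).1 (ends e).2.
Proof.
by move=> eT; apply/existsP; exists e; rewrite eT /joins -surjective_pairing eqxx.
Qed.

Lemma joinsP e x y : joins e x y ->
  (x = (ends e).1 /\ y = (ends e).2) \/ (x = (ends e).2 /\ y = (ends e).1).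
Proof. by rewrite /joins => /orP[] /eqP->; [left | right]. Qed.

(** Meant for a cycle opened at w: only the edges of c have to lie in T, the edge of w being the one
    removed. *)
Lemma walk_connect T (w z : vertex G * edge G) c :
  all (fun s => s.2 \in T) c ->
  path (fun s t => joins s.2 s.1 t.1) w (rcons c z) ->
  exists2 x, joins w.2 w.1 x & connect (adjacent T) x z.1.
Proof.
elim: c w => [|a c IHc] w /=; first by move=> _ /andP[wz _]; exists z.1.
case/andP=> aT cT /andP[wa /(IHc _ cT)[x ax xz]]; exists a.1 => //.
apply: connect_trans xz; apply: connect1; apply/existsP; exists a.2.
by rewrite aT.
Qed.

(** Only the vertex of z matters; it ends the walk. The clause on [ends] carries the distinctness of
    the edges through the induction: the edge leaving x cannot recur, as x is not on the rest of the
    path. *)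
Lemma path_walk T x p (z : vertex G * edge G) :
  path (adjacent T) x p -> uniq (x :: p) -> z.1 = last x p ->
  exists c : seq (vertex G * edge G),
    [/\ unzip1 c = belast x p, uniq (unzip2 c), all (fun s => s.2 \in T) c,
        forall s, s \in c -> ((ends s.2).1 \in x :: p) && ((ends s.2).2 \in x :: p)
      & forall w : vertex G * edge G, joins w.2 w.1 x ->
          path (fun s t => joins s.2 s.1 t.1) w (rcons c z)].
Proof.
elim: p x => [|y p IHp] x /=; first move=> _ _ zx.
  by exists [::]; split=> //= w; rewrite zx andbT.
case/andP=> /existsP[e /andP[eT exy]] yp /andP[xyp u_yp] zE.
have [c [c1 c2 cT cE cP]] := IHp y yp u_yp zE.
exists ((x, e) :: c); split => /=.
- by rewrite c1.
- rewrite c2 andbT; apply: contra xyp => /mapP[s sc es].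
  by have /andP[] := cE s sc; rewrite -es; case: (joinsP exy) => -[-> _].
- by rewrite eT.
- move=> s; rewrite inE => /orP[/eqP-> /=|/cE/andP[s1 s2]].
    by case: (joinsP exy) => -[<- <-]; rewrite !inE !eqxx ?orbT.
  by rewrite inE s1 orbT inE s2 orbT.
by move=> w ->; apply: cP.
Qed.

(** The rest of a cycle bypasses each of its edges; conversely a simple path avoiding e between the
    ends of e closes up with e. For a self-loop this path is empty. *)
Lemma acyclic_bridgeP T :
  reflect (forall e, e \in T ->
             ~~ connect (adjacent (T :\ e)) (ends e).1 (ends e).2)
          (acyclic T).
Proof.
apply: (iffP (acyclicP T)) => [acT e eT | bridge c].
  apply/negP; rewrite connect_adjacent_sym => /connectP[p0 p0P sE].
  case: (shortenP p0P) sE => p pP u_p _ sE.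
  have [c [c1 c2 cT _ cP]] := @path_walk _ _ _ ((ends e).1, e) pP u_p sE.
  have /negP := acT (((ends e).1, e) :: c); apply; apply/and5P; split => //=.
  - by rewrite c1 sE -rcons_uniq -lastI.
  - rewrite c2 andbT; apply/negP => /mapP[s sc es].
    by have /= := allP cT s sc; rewrite -es !inE eqxx.
  - rewrite eT; apply/allP => s sc.
    by have /= := allP cT s sc; rewrite inE => /andP[].
  - by apply: cP; rewrite /joins -surjective_pairing eqxx.
apply/negP => /and5P[]; case: c => // -[v e] c _ _ /= /andP[ec _] /andP[eT cT].
have cTe : all (fun s => s.2 \in T :\ e) c.
  apply/allP => s sc; rewrite !inE (allP cT s sc) andbT.
  by apply: contraNneq ec => <-; apply: map_f.
case/(walk_connect cTe) => x /= evx; move: (bridge e eT).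
by case: (joinsP evx) => -[<- <-]; [rewrite connect_adjacent_sym|]; move/negP.
Qed.

(** The omitted column is that of [ord_max], the vertex which [position] puts at the origin. Edges
    are oriented by the order in [ends]; this sign cancels in the Gram matrix and in [norm4]. A
    self-loop gives a zero row. *)
Definition incidence (R : comNzRingType) : 'M[R]_(NG G, nG G) :=
  \matrix_(e, p) (((ends e).1 == lift ord_max p)%:R -
                  ((ends e).2 == lift ord_max p)%:R).

Lemma sum_vertex (R : comNzRingType) (f : vertex G -> R) x : f ord_max = 0 ->
  \sum_p (x == lift ord_max p)%:R * f (lift ord_max p) = f x.
Proof.
move=> f0; case: (unliftP ord_max x) => [p|] ->; last first.
  rewrite f0 big1 // => p _.
  by rewrite (negbTE (neq_lift _ _)) mul0r.
rewrite (bigD1 p) //= eqxx mul1r big1 ?addr0 // => r neq_rp.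
by rewrite (inj_eq lift_inj) eq_sym (negbTE neq_rp) mul0r.
Qed.

Lemma sum_incidence (R : comNzRingType) (f : vertex G -> R) e : f ord_max = 0 ->
  \sum_p incidence R e p * f (lift ord_max p) = f (ends e).1 - f (ends e).2.
Proof.
move=> f0; rewrite -!(sum_vertex _ f0) -sumrB.
by apply: eq_bigr => p _; rewrite mxE mulrBl.
Qed.

(** The edge rows telescope along a path; [s] records the direction in which an edge is
    traversed. *)
Lemma connect_span (R : comNzRingType) T x y : connect (adjacent T) x y ->
  exists c : 'rV[R]_(NG G), c *m diag_mx (indic R T) *m incidence R =
    \row_p ((x == lift ord_max p)%:R - (y == lift ord_max p)%:R).
Proof.
case/connectP=> p; elim: p x => [|z p IHp] x /=.
  by move=> _ ->; exists 0; rewrite !mul0mx; apply/rowP => p; rewrite !mxE subrr.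
case/andP=> /existsP[e /andP[eT exz]] zp yE; have [c cE] := IHp z zp yE.
pose s : R := if x == (ends e).1 then 1 else -1.
exists (s *: delta_mx 0 e + c); rewrite !mulmxDl cE.
rewrite -!scalemxAl -mulmxA -rowE; apply/rowP => p'.
rewrite !mxE (bigD1 e) //= big1 ?addr0 => [|e' ne'].
  rewrite !mxE eqxx eT mulr1n mul1r addrA; congr (_ - _); rewrite /s.
  case: ifP => [/eqP xs|/negbT xs].
    case: (joinsP exz) => -[xE zE]; last first.
      by rewrite mul1r zE -xE -xs subrK.
    by rewrite mul1r -xE -zE subrK.
  case: (joinsP exz) => -[xE zE]; first by rewrite xE eqxx in xs.
  by rewrite mulN1r opprB -xE -zE subrK.
by rewrite !mxE eq_sym (negbTE ne') mulr0n mul0r.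
Qed.

(** Paths to [ord_max] produce all unit vectors. That X is integral later forces a determinant to be
    1 or -1. *)
Lemma connected_span T : connected_by T ->
  exists X, X *m diag_mx (indic int T) *m incidence int = 1%:M.
Proof.
move=> /forallP conT.
have /fin_all_exists[c cE] p := connect_span int (forallP (conT (lift ord_max p)) ord_max).
exists (\matrix_p c p); apply/row_matrixP => p; rewrite !row_mul rowK cE.
apply/rowP => r; rewrite !mxE (negbTE (neq_lift _ _)) subr0.
by rewrite (inj_eq lift_inj).
Qed.

Lemma leq_card_connected T : connected_by T -> (nG G <= #|T|)%N.
Proof.
case/connected_span => X; rewrite -selection_tr_mul -!mulmxA mulmxA.
exact: mulmx1_min.
Qed.

Lemma leq_card_acyclic T : acyclic T -> (#|T| <= nG G)%N.
Proof.
move/acyclic_bridgeP => bridge.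
(* The components cut off by the bridges are dual to the rows of the edges. *)
pose f e x : int := (connect (adjacent (T :\ e)) (ends e).1 x)%:R.
pose V := \matrix_(i < #|T|, p < nG G)
  (f (enum_val i) (lift ord_max p) - f (enum_val i) ord_max).
suff VB : V *m (selection T *m incidence int)^T = 1%:M by apply: mulmx1_min VB.
apply/matrixP => i j; rewrite /selection mul_rowsub_mx mul1mx !mxE.
under eq_bigr => p _ do rewrite [V _ _]mxE 2!mxE mulrC.
rewrite (sum_incidence (f := fun x => f (enum_val i) x - f (enum_val i) ord_max)) ?subrr //.
rewrite opprB addrA subrK; set e := enum_val i; set e' := enum_val j.
have [eT e'T] : e \in T /\ e' \in T by split; apply: enum_valP.
have [ij|neq_ij] := eqVneq i j.
  rewrite /e' -ij -/e /f connect0 (negbTE (bridge e eT)) subr0 //.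
have neq_e : e' != e by rewrite (inj_eq enum_val_inj) eq_sym.
rewrite /f (same_connect_r (connect_adjacent_sym _)
  (_ : connect (adjacent (T :\ e)) (ends e').1 (ends e').2)) ?subrr //.
by apply/connect1/adjacent_ends; rewrite !inE neq_e.
Qed.

(** The two cardinality bounds give one direction. For the other, an edge that is not a bridge could
    be removed from a connected set of n edges, leaving a connected set that is too small. *)
Lemma spanning_treeE T : spanning_tree T = (#|T| == nG G) && connected_by T.
Proof.
rewrite /spanning_tree andbC; apply/andP/andP => [[acT conT] | [/eqP cT conT]].
  by rewrite eqn_leq leq_card_acyclic ?leq_card_connected.
split=> //; apply/acyclic_bridgeP => e eT; apply/negP => con_e.
suff /leq_card_connected : connected_by (T :\ e) by rewrite -cT (cardsD1 e T) eT ltnn.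
apply/forallP => x; apply/forallP => y.
apply: connect_sub (forallP (forallP conT x) y) => {x y} x y /existsP[f /andP[fT fxy]].
have [fe|neq_fe] := eqVneq f e.
  rewrite fe in fxy; case: (joinsP fxy) => -[-> ->] //.
  by rewrite connect_adjacent_sym.
by apply: connect1; apply/existsP; exists f; rewrite !inE neq_fe fT.
Qed.

(** The square integer matrix Q B has the inverse X Q^T, so its determinant is 1 or -1, and the Gram
    determinant is its square. *)
Lemma det_gram_indic_connected T : #|T| = nG G -> connected_by T ->
  \det (gram (incidence int) (indic int T)) = 1.
Proof.
move=> cT /connected_span[X]; rewrite /gram -selection_tr_mul.
move: (selection T); rewrite cT => Q XQB.
have -> : (incidence int)^T *m (Q^T *m Q) *m incidence int =
    (Q *m incidence int)^T *m (Q *m incidence int).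
  by rewrite trmx_mul !mulmxA.
have := congr1 (fun M => \det M) XQB; rewrite -!mulmxA mulmxA !det_mulmx det1 det_tr.
move: (\det _) (\det _) => d d' /(congr1 absz)/eqP.
rewrite abszM muln_eq1 => /andP[/eqP d1 /eqP d'1]; nia.
Qed.

Lemma det_gram_indic_disconnected (R : idomainType) T : ~~ connected_by T ->
  \det (gram (incidence R) (indic R T)) = 0.
Proof.
move=> dcT; have [x dcx] : exists x, ~~ connect (adjacent T) x ord_max.
  apply/existsP; apply: contraNT dcT; rewrite negb_exists => /forallP con.
  have {}con x : connect (adjacent T) x ord_max by rewrite -[connect _ _ _]negbK.
  apply/forallP => x; apply/forallP => y; apply: connect_trans (con x) _.
  by rewrite connect_adjacent_sym.
(* The indicator of a component missing the root is constant along the edges of T, hence gives a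
   kernel vector. *)
pose f y : R := (connect (adjacent T) x y)%:R.
have f0 : f ord_max = 0 by rewrite /f (negbTE dcx).
apply/eqP/det0P; exists (\row_p f (lift ord_max p)).
  case: (unliftP ord_max x) dcx f0 => [p xE _ _|-> ]; last by rewrite connect0.
  apply/eqP => /rowP/(_ p); rewrite !mxE /f -xE connect0 => /eqP.
  by rewrite oner_eq0.
rewrite /gram !mulmxA (_ : _ *m diag_mx _ = 0) ?mul0mx //.
apply/rowP => e; rewrite mul_mx_diag mxE [RHS]mxE mxE.
under eq_bigr => p _ do rewrite mxE [X in _ * X]mxE mulrC.
rewrite (sum_incidence e f0) mxE.
have [eT|] := boolP (e \in T); last by rewrite mulr0.
rewrite /f (same_connect_r (connect_adjacent_sym _)
  (_ : connect (adjacent T) (ends e).1 (ends e).2)) ?subrr ?mul0r //.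
exact/connect1/adjacent_ends.
Qed.

Lemma det_gram_indic (R : idomainType) T : #|T| = nG G ->
  \det (gram (incidence R) (indic R T)) = (connected_by T)%:R.
Proof.
move=> cT; have [conT|dcT] := boolP (connected_by T); last first.
  exact: det_gram_indic_disconnected.
have := congr1 (fun z : int => z%:~R : R) (det_gram_indic_connected cT conT).
rewrite -det_map_mx map_gram rmorph1 => <-; congr (\det (gram _ _)).
  by apply/matrixP => e p; rewrite !mxE rmorphB /= !mulrz_nat.
by apply/rowP => e; rewrite !mxE mulrz_nat.
Qed.

Theorem matrix_tree (R : idomainType) (a : 'rV[R]_(NG G)) :
  \det (gram (incidence R) a) = \sum_(T | spanning_tree T) \prod_(e in T) a 0 e.
Proof.
rewrite det_gram_expand (eq_bigl _ _ spanning_treeE) big_mkcondr /=.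
apply: eq_bigr => T /eqP cT; rewrite det_gram_indic //.
by case: (connected_by T); rewrite ?mulr1 ?mulr0.
Qed.

(** * The two point counts in terms of matrices *)

Definition coordinates (R : comNzRingType) (x : {ffun 'I_(nG G * 4) -> R}) :
  'M[R]_(nG G, 4) := \matrix_(p, j) x (mxvec_index p j).

Lemma coordinates_bij (R : comNzRingType) : bijective (@coordinates R).
Proof.
exists (fun X => [ffun i => mxvec X 0 i]) => [x|X].
  by apply/ffunP => i; rewrite ffunE; case/mxvec_indexP: i => p j; rewrite mxvecE mxE.
by apply/matrixP => p j; rewrite mxE ffunE mxvecE.
Qed.

Lemma meval_position (R : comNzRingType) (x : {ffun 'I_(nG G * 4) -> R})
    (v : vertex G) j :
  (map_mpoly (intr : int -> R) (position v j)).@[x] =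
  \sum_p (v == lift ord_max p)%:R * coordinates x p j.
Proof.
pose f (v : vertex G) : R :=
  if unlift ord_max v is Some p then coordinates x p j else 0.
transitivity (f v).
  rewrite /position /f; case: unlift => [p|]; last by rewrite !rmorph0.
  by rewrite map_mpolyX mevalXU mxE.
rewrite -(sum_vertex (f := f)) /f ?unlift_none //.
by apply: eq_bigr => p _; rewrite liftK.
Qed.

Lemma meval_edge_poly (R : comNzRingType) (x : {ffun 'I_(nG G * 4) -> R}) e :
  (map_mpoly (intr : int -> R) (edge_poly e)).@[x] =
  norm4 ((incidence R *m coordinates x) e).
Proof.
have coordE j : (map_mpoly (intr : int -> R)
      (position (ends e).1 j - position (ends e).2 j)).@[x] =
    (incidence R *m coordinates x) e j.
  rewrite !rmorphB /= !meval_position mxE -sumrB; apply: eq_bigr => p _.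
  by rewrite [incidence _ _ _]mxE mulrBl.
by rewrite /edge_poly /norm4 rmorphD !rmorphM rmorphD !rmorphM /= !coordE.
Qed.

Lemma point_count_position (F : finFieldType) :
  point_count F [:: position_poly G] =
  #|[set X : 'M[F]_(nG G, 4) |
      [exists e, norm4 ((incidence F *m X) e) == 0]]|.
Proof.
rewrite -(on_card_preimset (onW_bij _ (coordinates_bij F))); apply: eq_card => x.
rewrite !inE /= andbT /position_poly !rmorph_prod /=.
apply/prodf_eq0/existsP => [[e _ xe]|[e xe]]; exists e => //.
  by rewrite -meval_edge_poly.
by rewrite meval_edge_poly.
Qed.

Lemma point_count_dual (F : finFieldType) :
  point_count F [:: dual_poly G] =
  #|[set a | \det (gram (incidence F) a) == 0]|.
Proof.
have row_bij : bijective (fun a : {ffun edge G -> F} => \row_e a e).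
  exists (fun a : 'rV[F]_(NG G) => [ffun e => a 0 e]) => [a|a].
    by apply/ffunP => e; rewrite ffunE mxE.
  by apply/rowP => e; rewrite mxE ffunE.
rewrite -(on_card_preimset (onW_bij _ row_bij)); apply: eq_card => a.
rewrite !inE /= andbT matrix_tree /dual_poly.
rewrite (rmorph_sum (map_mpoly (intr : int -> F))) rmorph_sum /=; congr (_ == 0).
apply: eq_bigr => T _; rewrite !rmorph_prod; apply: eq_bigr => e _ /=.
by rewrite map_mpolyX mevalXU mxE.
Qed.

End Graph.

Lemma log_divergentE (G : mgraph) : log_divergent G -> NG G = (nG G + nG G)%N.
Proof. by rewrite /log_divergent /hG; lia. Qed.

(** The invariants are quotients by q^2 taken modulo q, so point counts modulo q^3 determine
    them. *)
Lemma divn_sqr_mod q a b : (a = b %[mod q ^ 3] -> a %/ q ^ 2 = b %/ q ^ 2 %[mod q])%N.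
Proof.
by rewrite !modn_divl -expnS => ->.
Qed.

Local Close Scope ring_scope.

(* [F] ranges over the finite fields, i.e. q = #|F| over the prime powers. *)
Theorem theorem3 (G : mgraph) (hlog : log_divergent G) (hn : 3 <= nG G)
  (F : finFieldType) : c2_dual G F = c2_pos G F.
Proof.
rewrite /c2_dual /c2_pos point_count_dual point_count_position.
(* The modulus of ['Z_k] is k only for k > 1. *)
have q_gt1 := card_finNzRing_gt1 F; rewrite -[LHS]Zp_nat_mod // -[RHS]Zp_nat_mod //.
by congr _%:R%R; apply/esym/divn_sqr_mod/card_norm4_eq0_det/hn/log_divergentE.
Qed.
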